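(* Let $G$ be a finite, undirected, simple, connected graph. Then $G\in\mathbf{m_3}/\mathbf{l_3}$ if and only if $G$ is $\{\text{hole}, D, F, X_5\}$-free. That is, $\mathbf{m_3}/\mathbf{l_3}=\{\text{hole}, D, F, X_5\}$-free.
   Context: All graphs are finite, undirected, simple and connected. A $uv$-walk is a sequence of (not necessarily distinct) vertices $W: u=v_0,v_1,\ldots,v_n=v$ with $v_{i-1}$ adjacent to $v_i$ for all $i\in\{1,\ldots,n\}$; $v_1,\ldots,v_{n-1}$ are its internal vertices and $n$ is its length. A $uv$-path is a $uv$-walk with distinct vertices. A $uv$-induced path is a $uv$-path in which two vertices are adjacent in $G$ if and only if they are consecutive on the path. For non-adjacent vertices $u,v$: - $\mathbf{m_3}(u,v)$ is the set of $uv$-$m_3$ paths, i.e. $uv$-induced paths of length at least three. - $\mathbf{l_3}(u,v)$ is the set of $uv$-$l_3$-paths, i.e. $uv$-induced paths of length at most $3$. Domination: for non-adjacent $u,v$, a $uv$-walk $W$ dominates a $uv$-walk $W'$ if every internal vertex of $W'$ is adjacent to some internal vertex of $W$ or belongs to $W$. The class $\mathbf{A}/\mathbf{B}$ consists of all graphs $G$ such that for every pair of non-adjacent vertices $u,v$ of $G$, every walk $W\in\mathbf{A}(u,v)$ dominates every walk $W'\in\mathbf{B}(u,v)$ (vacuously true if one of the sets is empty). A graph is $\mathcal{F}$-free if it contains no induced subgraph isomorphic to a member of $\mathcal{F}$. The graphs involved are: - a hole: a chordless cycle with at least five vertices (every such cycle is forbidden); - $D$ (domino): vertices $x_0,\ldots,x_5$,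 edges $x_0x_1,x_1x_2,x_2x_3,x_3x_4,x_4x_5,x_0x_5,x_1x_4$; - $X_5$: vertices $x_0,\ldots,x_5$, edges $x_0x_1,x_0x_5,x_1x_2,x_1x_5,x_2x_3,x_2x_5,x_3x_4,x_4x_5$; - $F$: vertices $x_0,\ldots,x_6$, edges $x_0x_1,x_0x_6,x_1x_2,x_2x_6,x_5x_6,x_2x_3,x_2x_5,x_3x_4,x_4x_5$. *)

(* Defs.v *)
From mathcomp Require Import all_boot.

Set Implicit Arguments.
Unset Strict Implicit.
Unset Printing Implicit Defensive.

Record sgraph := SGraph {
  svertex :> finType;
  adj : rel svertex;
  adj_sym : symmetric adj;
  adj_irrefl : irreflexive adj
}.

Definition connected (G : sgraph) : Prop := forall x y : G, connect (@adj G) x y.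

(** A walk v_0, ..., v_n is the sequence of all its vertices, so that it has
    length [(size W).-1]. *)

Definition is_walk (G : sgraph) (u v : G) (W : seq G) : Prop :=
  if W is x :: p then [/\ x = u, path (@adj G) x p & last x p = v] else False.

Definition wlength (G : sgraph) (W : seq G) : nat := (size W).-1.

Definition internal (G : sgraph) (W : seq G) : seq G :=
  behead (take (wlength W) W).

Definition is_path (G : sgraph) (u v : G) (W : seq G) : Prop :=
  is_walk u v W /\ uniq W.

Definition is_induced_path (G : sgraph) (u v : G) (W : seq G) : Prop :=
  is_path u v W /\
  forall i j : nat, i < size W -> j < size W ->
    adj (nth u W i) (nth u W j) <-> (j = i.+1 \/ i = j.+1).

(** A kind of walks assigns to each graph and each pair u, v a set of
    uv-walks; the class A/B is defined for two arbitrary kinds. *)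

Definition walk_kind := forall G : sgraph, G -> G -> seq G -> Prop.

Definition m3 : walk_kind := fun G u v W =>
  is_induced_path u v W /\ 3 <= wlength W.

Definition l3 : walk_kind := fun G u v W =>
  is_induced_path u v W /\ wlength W <= 3.

Definition dominates (G : sgraph) (W W' : seq G) : Prop :=
  forall x : G, x \in internal W' ->
    (exists2 y : G, y \in internal W & adj x y) \/ x \in W.

Definition domination_class (A B : walk_kind) (G : sgraph) : Prop :=
  forall u v : G, u != v -> ~~ adj u v ->
  forall W W' : seq G, A G u v W -> B G u v W' -> dominates W W'.

Section Induced.
Variables (G : sgraph) (S : {set G}).

Definition induced_adj : rel {x : G | x \in S} :=
  fun x y => adj (val x) (val y).

Lemma induced_sym : symmetric induced_adj.
Proof. by move=> x y; apply: adj_sym. Qed.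

Lemma induced_irrefl : irreflexive induced_adj.
Proof. by move=> x; apply: adj_irrefl. Qed.

Definition induced : sgraph := SGraph induced_sym induced_irrefl.

End Induced.

Definition isomorphic (G H : sgraph) : Prop :=
  exists2 f : G -> H, bijective f & forall x y : G, adj (f x) (f y) = adj x y.

Definition free_of (F : sgraph -> Prop) (G : sgraph) : Prop :=
  forall H : sgraph, F H -> forall S : {set G}, ~ isomorphic (induced S) H.

Section EdgeList.
Variables (n : nat) (E : seq (nat * nat)).

(** The test [i != j] discards loops, so that every edge list is allowed. *)
Definition edge_list_adj : rel 'I_n := fun i j =>
  (i != j) && (((i : nat, j : nat) \in E) || ((j : nat, i : nat) \in E)).

Lemma edge_list_sym : symmetric edge_list_adj.
Proof. by move=> i j; rewrite /edge_list_adj eq_sym orbC. Qed.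

Lemma edge_list_irrefl : irreflexive edge_list_adj.
Proof. by move=> i; rewrite /edge_list_adj eqxx. Qed.

Definition edge_list_graph : sgraph := SGraph edge_list_sym edge_list_irrefl.

End EdgeList.

Definition cycle_graph (n : nat) : sgraph :=
  edge_list_graph n [seq (i, i.+1 %% n) | i <- iota 0 n].

Definition domino : sgraph :=
  edge_list_graph 6
    [:: (0, 1); (1, 2); (2, 3); (3, 4); (4, 5); (0, 5); (1, 4)].

Definition graph_X5 : sgraph :=
  edge_list_graph 6
    [:: (0, 1); (0, 5); (1, 2); (1, 5); (2, 3); (2, 5); (3, 4); (4, 5)].

Definition graph_F : sgraph :=
  edge_list_graph 7
    [:: (0, 1); (0, 6); (1, 2); (2, 6); (5, 6); (2, 3); (2, 5); (3, 4); (4, 5)].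

Inductive hole_D_F_X5 : sgraph -> Prop :=
| is_hole n of 5 <= n : hole_D_F_X5 (cycle_graph n)
| is_domino : hole_D_F_X5 domino
| is_F : hole_D_F_X5 graph_F
| is_X5 : hole_D_F_X5 graph_X5.

(* Main.v *)
Require Import Defs.
From mathcomp Require Import all_boot.
From mathcomp Require Import zify.

(** An undominated internal vertex [a] of a short path W' has no internal
    vertex of W as a neighbour.  If W' has length two, [a] closes W into a hole.
    Otherwise, up to reversal, W' = u a b v.  Following W from u, the absence of
    holes forces the second vertex of W to be a neighbour of [b], and then any
    two consecutive neighbours of [b] on W to be at distance one or two.  If the
    first of these distances is 2 there is a domino; if the first two are 1, 1
    there is an X5, and if they are 1, 2 there is an F.  Conversely every
    forbidden graph contains two paths that violate domination. *)

Set Implicit Arguments.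
Unset Strict Implicit.
Unset Printing Implicit Defensive.

(** * Vertices as natural numbers, embeddings and twins *)

Definition edge_rel (E : seq (nat * nat)) : rel nat := fun i j =>
  (i != j) && (((i, j) \in E) || ((j, i) \in E)).

(** Adjacency-preserving maps out of a twin-free graph are injective, so that
    distinctness never has to be checked when a forbidden subgraph is exhibited. *)
Definition twin_free (n : nat) (e : rel nat) : Prop :=
  forall i j, i < n -> j < n -> (forall l, l < n -> e i l = e j l) -> i = j.

(** Only the values of [g] below [n] matter; injectivity is left to twin-freeness of [e]. *)
Definition embeds (G : sgraph) (n : nat) (e : rel nat) (g : nat -> G) : Prop :=
  forall i j, i < n -> j < n -> adj (g i) (g j) = e i j.

Definition path_rel : rel nat := fun i j => (j == i.+1) || (i == j.+1).

Lemma embeds_inj (G : sgraph) n e (g : nat -> G) :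
  twin_free n e -> embeds n e g ->
  forall i j, i < n -> j < n -> g i = g j -> i = j.
Proof.
move=> tf ge i j ltin ltjn eqg; apply: tf => // l ltln.
by rewrite -!ge // eqg.
Qed.

Lemma embeds_isomorphic (G : sgraph) n E (g : nat -> G) :
  twin_free n (edge_rel E) -> embeds n (edge_rel E) g ->
  exists S : {set G}, isomorphic (induced S) (edge_list_graph n E).
Proof.
move=> tf ge; pose S := [set g i | i : 'I_n].
have gS (i : 'I_n) : g i \in S by apply: imset_f.
pose h (i : edge_list_graph n E) : induced S := Sub (g i) (gS i).
have injh : injective h.
  move=> i j /(congr1 val) /= eqg; apply: val_inj.
  exact: (embeds_inj tf ge (ltn_ord i) (ltn_ord j)).
(* An image has no more elements than its domain, so the injection [h] is a bijection. *)
have cardS : #|induced S| <= #|edge_list_graph n E|.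
  by rewrite card_sig; apply: leq_imset_card.
have [f hK fK] := inj_card_bij injh cardS.
exists S, f => [|x y]; first by exists h.
rewrite -[in RHS](fK x) -[in RHS](fK y).
by rewrite /adj /= /induced_adj /= (ge _ _ (ltn_ord _) (ltn_ord _)).
Qed.

(** The size is a successor so that [inord] can extend the inverse isomorphism to all natural
    numbers. *)
Lemma isomorphic_embeds (G : sgraph) n E (S : {set G}) :
  isomorphic (induced S) (edge_list_graph n.+1 E) ->
  exists g : nat -> G, embeds n.+1 (edge_rel E) g.
Proof.
case=> f [h fK hK] fadj; exists (fun i => val (h (inord i))) => i j ltin ltjn.
have -> : adj (val (h (inord i))) (val (h (inord j))) =
  adj (h (inord i)) (h (inord j)) by [].
rewrite -fadj !hK /= /edge_list_adj /edge_rel.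
by rewrite -(inj_eq val_inj) /= !inordK.
Qed.

(** * Twin-freeness of the forbidden graphs *)

Lemma cycle_edgeE n i j : 1 < n -> i < n -> j < n ->
  edge_rel [seq (l, l.+1 %% n) | l <- iota 0 n] i j =
  [|| path_rel i j, (i == 0) && (j.+1 == n) | (j == 0) && (i.+1 == n)].
Proof.
move=> n_gt1 ltin ltjn.
have mem_cycle a b : a < n ->
    ((a, b) \in [seq (l, l.+1 %% n) | l <- iota 0 n]) =
    (b == if a.+1 == n then 0 else a.+1).
  move=> ltan; have -> : (if a.+1 == n then 0 else a.+1) = a.+1 %% n.
    by case: eqP => [->|neq]; rewrite ?modnn // modn_small; lia.
  apply/mapP/eqP => [[l _ [-> ->]] //|->].
  by exists a; rewrite // mem_iota.
rewrite /edge_rel /path_rel !mem_cycle //.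
by have [?|?] := eqVneq i.+1 n; have [?|?] := eqVneq j.+1 n; lia.
Qed.

Lemma twin_free_cycle n : 5 <= n ->
  twin_free n (edge_rel [seq (l, l.+1 %% n) | l <- iota 0 n]).
Proof.
move=> n_ge5; have no_twin i j : i < j < n ->
    (forall l, l < n -> edge_rel [seq (l, l.+1 %% n) | l <- iota 0 n] i l =
                        edge_rel [seq (l, l.+1 %% n) | l <- iota 0 n] j l) ->
    False.
  (* The neighbour [i.+1] of [i] is shared by [j], which forces [j = i.+2]. The other neighbour of
     [j], which is [0] or [i.+3], is adjacent to [i] only in a cycle of length 4. *)
  move=> ltijn twin; have ej : j = i.+2.
    have := twin i.+1 ltac:(lia).
    by rewrite !cycle_edgeE /path_rel ?eqxx; try lia.
  subst j; have [eqn|neqn] := eqVneq i.+3 n.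
    have := twin 0 ltac:(lia).
    by rewrite !cycle_edgeE /path_rel; lia.
  have := twin i.+3 ltac:(lia).
  by rewrite !cycle_edgeE /path_rel; lia.
move=> i j ltin ltjn twin; case: (ltngtP i j) => // ltij; exfalso.
- by apply: (no_twin i j) => //; rewrite ltij.
- by apply: (no_twin j i) => [|l ltl]; rewrite ?ltij // twin.
Qed.

Lemma twin_free_all n (e : rel nat) :
  all (fun i => all (fun j =>
    (i == j) || has (fun l => e i l != e j l) (iota 0 n)) (iota 0 n)) (iota 0 n)
  -> twin_free n e.
Proof.
move=> /allP tf i j ltin ltjn twin.
have in_iota l : l < n -> l \in iota 0 n by rewrite mem_iota.
have /allP/(_ j (in_iota _ ltjn)) := tf i (in_iota _ ltin).
case/orP=> [/eqP //|/hasP[l]]; rewrite mem_iota => ltln.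
by rewrite twin ?eqxx.
Qed.

Definition domino_edges :=
  [:: (0, 1); (1, 2); (2, 3); (3, 4); (4, 5); (0, 5); (1, 4)].
Definition X5_edges :=
  [:: (0, 1); (0, 5); (1, 2); (1, 5); (2, 3); (2, 5); (3, 4); (4, 5)].
Definition F_edges :=
  [:: (0, 1); (0, 6); (1, 2); (2, 6); (5, 6); (2, 3); (2, 5); (3, 4); (4, 5)].

Lemma twin_free_domino : twin_free 6 (edge_rel domino_edges).
Proof. exact: twin_free_all. Qed.

Lemma twin_free_X5 : twin_free 6 (edge_rel X5_edges).
Proof. exact: twin_free_all. Qed.

Lemma twin_free_F : twin_free 7 (edge_rel F_edges).
Proof. exact: twin_free_all. Qed.

(** * Induced paths as functions of the position *)

Lemma nth_mkseq_wlength (G : sgraph) (u v : G) W : is_walk u v W ->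
  W = mkseq (nth u W) (wlength W).+1.
Proof. by case: W => //= x p _; rewrite -[LHS](mkseq_nth u). Qed.

Lemma internal_mkseq (G : sgraph) (w : nat -> G) k :
  internal (mkseq w k.+1) = [seq w i | i <- iota 1 k.-1].
Proof.
rewrite /internal /wlength size_mkseq /mkseq -map_take take_iota.
have -> : minn k.+1.-1 k.+1 = k by lia.
by case: k.
Qed.

(** Distinctness is kept beside the embedding because the ends of a path of length two are twins. *)
Lemma induced_path_mkseq (G : sgraph) (u v : G) w k :
  is_induced_path u v (mkseq w k.+1) <->
  [/\ w 0 = u, w k = v, uniq (mkseq w k.+1) & embeds k.+1 path_rel w].
Proof.
have nthw i : i < k.+1 -> nth u (mkseq w k.+1) i = w i by exact: nth_mkseq.
have last_w x : last x (mkseq w k.+1) = w k by rewrite mkseqS last_rcons.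
split=> [[[walk uW] adjP]|[w0 wk uW wadj]].
- split=> //.
  + by case: walk.
  + by case: walk => _ _ <-; rewrite -(last_w u).
  + move=> i j ltik ltjk; have := adjP i j; rewrite size_mkseq !nthw //.
    move=> /(_ ltik ltjk) adjE; apply/idP/idP => [/adjE|]; rewrite /path_rel.
      by case=> ->; rewrite eqxx ?orbT.
    by move=> e; apply/adjE; case/orP: e => /eqP; [left|right].
- split; first split=> //.
  + split=> //; last by rewrite -wk -(last_w u).
    apply/(pathP u) => i; rewrite size_map size_iota => ltik.
    rewrite (nth_map 0) ?size_iota // nth_iota //.
    have -> : nth u (w 0 :: map w (iota 1 k)) i = w i by apply: nthw; lia.
    by rewrite wadj /path_rel ?add1n ?eqxx //; lia.
  + move=> i j; rewrite size_mkseq => ltik ltjk; rewrite !nthw // wadj //.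
    by split=> [/orP[]/eqP|[]->]; [left|right| |]; rewrite /path_rel ?eqxx ?orbT.
Qed.

(** * Every forbidden graph violates domination *)

Lemma not_domination (G : sgraph) (w w' : nat -> G) k k' i :
  uniq (mkseq w k.+1) -> embeds k.+1 path_rel w -> 3 <= k ->
  uniq (mkseq w' k'.+1) -> embeds k'.+1 path_rel w' -> k' <= 3 ->
  w' 0 = w 0 -> w' k' = w k -> 0 < i < k' ->
  (forall j, 0 < j < k -> ~~ adj (w' i) (w j)) ->
  w' i \notin mkseq w k.+1 ->
  ~ domination_class m3 l3 G.
Proof.
move=> uw we k3 uw' we' k'3 w0 wk lti nadj nin dom.
(* Since [k] is at least 3, [w 1] is adjacent to [w 0] but not to [w k]. *)
have neq : w 0 != w k.
  apply/eqP => eqw; have := we 0 1 isT ltac:(lia).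
  by rewrite eqw we /path_rel; lia.
have nadj0k : ~~ adj (w 0) (w k) by rewrite we /path_rel; lia.
have mW : m3 (w 0) (w k) (mkseq w k.+1).
  by split; rewrite /wlength ?size_mkseq //; apply/induced_path_mkseq.
have lW' : l3 (w 0) (w k) (mkseq w' k'.+1).
  by split; rewrite /wlength ?size_mkseq //; apply/induced_path_mkseq.
have := dom _ _ neq nadj0k _ _ mW lW' (w' i).
case; last by apply/negP.
- by rewrite internal_mkseq map_f // mem_iota; lia.
case=> y; rewrite internal_mkseq => /mapP[j]; rewrite mem_iota => ltj ->.
by apply/negP/nadj; lia.
Qed.

(** Both paths live in the pattern [e], so all conditions concern indices and are carried to [G] by
    [g]. The undominated vertex is at position 1 of [s']. *)
Lemma not_domination_embeds (G : sgraph) n e (g : nat -> G) s s' k k' :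
  twin_free n e -> embeds n e g ->
  (forall i, i <= k -> s i < n) -> (forall i, i <= k' -> s' i < n) ->
  uniq (mkseq s k.+1) -> uniq (mkseq s' k'.+1) ->
  (forall i j, i <= k -> j <= k -> e (s i) (s j) = path_rel i j) ->
  (forall i j, i <= k' -> j <= k' -> e (s' i) (s' j) = path_rel i j) ->
  3 <= k -> 1 < k' <= 3 -> s' 0 = s 0 -> s' k' = s k ->
  (forall j, 0 < j < k -> ~~ e (s' 1) (s j)) -> s' 1 \notin mkseq s k.+1 ->
  ~ domination_class m3 l3 G.
Proof.
move=> tf ge ltsn lts'n us us' se se' k3 /andP[k'1 k'3] s0 sk nadj nin.
have uniq_g t l : (forall i, i <= l -> t i < n) -> uniq (mkseq t l.+1) ->
    uniq (mkseq (g \o t) l.+1).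
  move=> lttn ut; rewrite /mkseq map_comp map_inj_in_uniq //.
  move=> _ _ /mapP[a + ->] /mapP[b + ->]; rewrite !mem_iota => lta ltb.
  by apply: (embeds_inj tf ge); apply: lttn; lia.
apply: (@not_domination G (g \o s) (g \o s') k k' 1 (uniq_g _ _ ltsn us) _ k3
          (uniq_g _ _ lts'n us') _ k'3); rewrite /= ?s0 ?sk ?k'1 //.
- by move=> i j lti ltj /=; rewrite ge ?se //; apply: ltsn; lia.
- by move=> i j lti ltj /=; rewrite ge ?se' //; apply: lts'n; lia.
- by move=> j ltj; rewrite ge ?nadj //; [apply: lts'n | apply: ltsn]; lia.
- apply: contra nin => /mapP[j]; rewrite mem_iota => ltj eqg; apply/mapP.
  exists j; rewrite ?mem_iota //.
  by apply: (embeds_inj tf ge) => //; [apply: lts'n | apply: ltsn]; lia.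
Qed.

Lemma not_domination_cycle (G : sgraph) n (g : nat -> G) : 5 <= n ->
  embeds n (edge_rel [seq (l, l.+1 %% n) | l <- iota 0 n]) g ->
  ~ domination_class m3 l3 G.
Proof.
move=> n5 ge.
(* The two arcs between [0] and [n - 2] are used: [id] runs along the long one, [s'] passes through
   [n - 1]. *)
pose s' i := if i == 0 then 0 else n - i.
apply: (@not_domination_embeds G n _ g id s' (n - 2) 2
          (twin_free_cycle n5) ge) => //.
- by lia.
- by rewrite /s' => i; case: eqP; lia.
- by rewrite /mkseq map_id iota_uniq.
- by rewrite /s' /= !inE; lia.
- by move=> i j lti ltj; rewrite cycle_edgeE; lia.
- by case=> [|[|[|i]]] [|[|[|j]]] // _ _;
    rewrite cycle_edgeE /path_rel /s' /=; lia.
- by lia.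
- by move=> j ltj; rewrite cycle_edgeE /path_rel /s' /=; lia.
- by rewrite /mkseq map_id mem_iota /s' /=; lia.
Qed.

(** For a concrete pattern every condition is boolean and settled by computation. The second vertex
    of the short path [s'] is the undominated one. *)
Lemma not_domination_seq (G : sgraph) n e (g : nat -> G) s s' :
  twin_free n e -> embeds n e g ->
  let check t := all (fun i => (nth 0 t i < n) && all (fun j =>
    e (nth 0 t i) (nth 0 t j) == path_rel i j) (iota 0 (size t)))
    (iota 0 (size t)) in
  [&& check s, check s', uniq s & uniq s'] ->
  [&& 4 <= size s, 3 <= size s' <= 4, nth 0 s' 0 == nth 0 s 0,
      last 0 s' == last 0 s, nth 0 s' 1 \notin s &
      all (fun j => ~~ e (nth 0 s' 1) (nth 0 s j)) (iota 1 (size s).-2)] ->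
  ~ domination_class m3 l3 G.
Proof.
move=> tf ge check /and4P[cs cs' us us'] /and5P[s4 s'34 s0 slast /andP[nin nadj]].
have mk (t : seq nat) : 0 < size t -> mkseq (nth 0 t) (size t).-1.+1 = t.
  by move=> t0; rewrite prednK // -[RHS](mkseq_nth 0).
have checkP t : check t -> forall i, i < size t -> nth 0 t i < n /\
    forall j, j < size t -> e (nth 0 t i) (nth 0 t j) = path_rel i j.
  move=> /allP ct i lti; have /ct/andP[ltn /allP ce] : i \in iota 0 (size t).
    by rewrite mem_iota.
  by split=> // j ltj; apply/eqP/ce; rewrite mem_iota.
have lt_size (t : seq nat) i : 0 < size t -> i <= (size t).-1 -> i < size t by lia.
have [s_gt0 s'_gt0] : 0 < size s /\ 0 < size s' by lia.
apply: (@not_domination_embeds G n e g (nth 0 s) (nth 0 s') (size s).-1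
          (size s').-1) => //; rewrite ?mk //.
- by move=> i lti; case: (checkP s cs i (lt_size _ _ s_gt0 lti)).
- by move=> i lti; case: (checkP s' cs' i (lt_size _ _ s'_gt0 lti)).
- move=> i j /(lt_size _ _ s_gt0) lti /(lt_size _ _ s_gt0) ltj.
  by case: (checkP s cs i lti) => _ ->.
- move=> i j /(lt_size _ _ s'_gt0) lti /(lt_size _ _ s'_gt0) ltj.
  by case: (checkP s' cs' i lti) => _ ->.
- by lia.
- by lia.
- exact/eqP.
- by rewrite !nth_last; apply/eqP.
- by move=> j ltj; apply: (allP nadj); rewrite mem_iota; lia.
Qed.

Lemma not_domination_domino (G : sgraph) (g : nat -> G) :
  embeds 6 (edge_rel domino_edges) g -> ~ domination_class m3 l3 G.
Proof.
move=> ge; exact: (@not_domination_seq G 6 _ g [:: 0; 1; 2; 3] [:: 0; 5; 4; 3]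
  twin_free_domino).
Qed.

Lemma not_domination_X5 (G : sgraph) (g : nat -> G) :
  embeds 6 (edge_rel X5_edges) g -> ~ domination_class m3 l3 G.
Proof.
move=> ge; exact: (@not_domination_seq G 6 _ g [:: 3; 2; 1; 0] [:: 3; 4; 5; 0]
  twin_free_X5).
Qed.

Lemma not_domination_F (G : sgraph) (g : nat -> G) :
  embeds 7 (edge_rel F_edges) g -> ~ domination_class m3 l3 G.
Proof.
move=> ge; exact: (@not_domination_seq G 7 _ g [:: 0; 6; 5; 4; 3] [:: 0; 1; 2; 3]
  twin_free_F).
Qed.

Lemma domination_free (G : sgraph) :
  domination_class m3 l3 G -> free_of hole_D_F_X5 G.
Proof.
move=> dom H [n n5|||] S.
- case: n n5 => // n n5 /isomorphic_embeds[g ge].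
  exact: not_domination_cycle ge dom.
- by move=> /isomorphic_embeds[g ge]; exact: not_domination_domino ge dom.
- by move=> /isomorphic_embeds[g ge]; exact: not_domination_F ge dom.
- by move=> /isomorphic_embeds[g ge]; exact: not_domination_X5 ge dom.
Qed.

(** * Exhibiting a forbidden subgraph *)

Lemma embeds_nth (G : sgraph) n e (s : nat -> G) :
  symmetric e -> irreflexive e ->
  (forall i j, i < j < n -> adj (s i) (s j) = e i j) -> embeds n e s.
Proof.
move=> esym eirr se i j lti ltj.
have [ltij|ltji|->] := ltngtP i j.
- by rewrite se ?ltij.
- by rewrite adj_sym esym se ?ltji.
- by rewrite adj_irrefl eirr.
Qed.

Lemma edge_rel_sym E : symmetric (edge_rel E).
Proof. by move=> i j; rewrite /edge_rel eq_sym orbC. Qed.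

Lemma edge_rel_irrefl E : irreflexive (edge_rel E).
Proof. by move=> i; rewrite /edge_rel eqxx. Qed.

Lemma no_embeds (G : sgraph) n E (s : nat -> G) :
  free_of hole_D_F_X5 G -> hole_D_F_X5 (edge_list_graph n E) ->
  twin_free n (edge_rel E) ->
  (forall i j, i < j < n -> adj (s i) (s j) = edge_rel E i j) -> False.
Proof.
move=> Gfree bad tf /(embeds_nth (edge_rel_sym E) (edge_rel_irrefl E)) se.
by have [S] := embeds_isomorphic tf se; apply: (Gfree _ bad).
Qed.

(** For concrete [n] the last hypothesis unfolds to a finite conjunction, provable by rewriting with
    known adjacencies. *)
Lemma no_embeds_pairwise (G : sgraph) n E (s : nat -> G) :
  free_of hole_D_F_X5 G -> hole_D_F_X5 (edge_list_graph n E) ->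
  twin_free n (edge_rel E) ->
  pairwise (fun i j => adj (s i) (s j) == edge_rel E i j) (iota 0 n) -> False.
Proof.
move=> Gfree bad tf /(pairwiseP 0) sE; apply: (no_embeds (s := s) Gfree bad tf).
move=> i j ltij; have [ltin ltjn] : i < n /\ j < n by lia.
have := sE i j; rewrite !inE size_iota => /(_ ltin ltjn).
by rewrite !nth_iota // => /(_ ltac:(lia))/eqP.
Qed.

(** * Freeness implies domination *)

Lemma hole_of_path (G : sgraph) (w : nat -> G) k x :
  free_of hole_D_F_X5 G -> 3 <= k -> embeds k.+1 path_rel w ->
  (forall i, i <= k -> adj x (w i) = (i == 0) || (i == k)) -> False.
Proof.
move=> Gfree k3 we xw.
(* Position [k.+1] carries [x], which closes the path into a cycle of length [k.+2], at least 5. *)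
apply: (@no_embeds G k.+2 _ (fun i => if i <= k then w i else x) Gfree).
- exact: (@is_hole k.+2).
- exact: (@twin_free_cycle k.+2).
- move=> i j ltij; rewrite cycle_edgeE /path_rel; try lia.
  have -> : i <= k by lia.
  case: ifP => ltjk; first by rewrite we /path_rel; lia.
  by rewrite adj_sym xw; lia.
Qed.

(** The short path is [w 0], [a], [b], [w k] with [a] undominated. The neighbours of [b] inside [w]
    are unknown and are explored starting from [w 0]. *)
Lemma undominated_path_False (G : sgraph) (w : nat -> G) k a b :
  free_of hole_D_F_X5 G -> 3 <= k -> embeds k.+1 path_rel w ->
  (forall i, i <= k -> adj a (w i) = (i == 0)) -> ~~ adj b (w 0) ->
  adj b (w k) -> adj a b -> False.
Proof.
move=> Gfree k3 we aw nb0 bk ab.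
(* The next neighbour of [b] after position [i] exists because [w k] is one. *)
have next i : i < k -> exists2 j, i < j <= k & adj b (w j) /\
    forall l, i < l < j -> ~~ adj b (w l).
  move=> ltik; have ex : exists j, (i < j) && adj b (w j).
    by exists k; rewrite ltik.
  case: (ex_minnP ex) => j /andP[ltij bj] minj; exists j.
    by rewrite ltij minj // ltik.
  by split=> // l ltl; apply/negP => bl; have := minj l; rewrite bl; lia.
(* At distance three or more, the segment between consecutive neighbours of [b] would form a hole
   with [b]. *)
have gap i j : i < j <= k -> adj b (w i) -> adj b (w j) ->
    (forall l, i < l < j -> ~~ adj b (w l)) -> j <= i.+2.
  move=> ltij bi bj nb; rewrite leqNgt; apply/negP => gap.
  apply: (@hole_of_path G (fun l => w (i + l)) (j - i) b Gfree); first lia.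
    by move=> l m ltl ltm; rewrite we /path_rel; lia.
  move=> l ltl; have [->|l0] := eqVneq l 0; first by rewrite addn0 bi.
  have [->|lj] := eqVneq l (j - i); first by rewrite subnKC ?bj //; lia.
  by apply/negbTE/nb; lia.
(* If the first neighbour [w j] came later, [b] would close the path [a], [w 0], ..., [w j], of
   length at least 3, into a hole. *)
have b1 : adj b (w 1).
  have [j ltj [bj nb]] := next 0 ltac:(lia).
  have [j_le1|j_gt1] := leqP j 1; first by have <- : j = 1 by lia.
  exfalso; apply: (@hole_of_path G (fun l => if l is l'.+1 then w l' else a)
            j.+1 b Gfree).
  - by lia.
  - move=> [|l] [|m] ltl ltm; rewrite ?adj_irrefl ?we 1?[adj (w _) a]adj_sym ?aw;
      rewrite /path_rel; lia.
  - move=> [|l] ltl; first by rewrite adj_sym ab.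
    have [->|lj] := eqVneq l j; first by rewrite bj eqxx.
    have [->|l0] := eqVneq l 0; first by rewrite (negbTE nb0); lia.
    by rewrite (negbTE (nb l _)) //; lia.
have [b0 ba] : adj b (w 0) = false /\ adj b a.
  by rewrite (negbTE nb0) adj_sym.
(* With a numeral for [m], the bounds on concrete indices compute and only [m <= k] remains. *)
have wem m i j : m <= k -> i <= m -> j <= m -> adj (w i) (w j) = path_rel i j.
  by move=> mk im jm; rewrite we //; lia.
have awm m i : m <= k -> i <= m -> adj a (w i) = (i == 0).
  by move=> mk im; rewrite aw //; lia.
have wa l : adj (w l) a = adj a (w l) by exact: adj_sym.
have wb l : adj (w l) b = adj b (w l) by exact: adj_sym.
have [j ltj [bj nbj]] := next 1 ltac:(lia).
have := gap 1 j ltj b1 bj nbj; case: (leqP j 2) => j2 j3; last first.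
  have ej : j = 3 by lia.
  subst j; have b2 := negbTE (nbj 2 isT).
  (* The squares [w 0], [w 1], [b], [a] and [w 1], [w 2], [w 3], [b] share the edge from [w 1] to
     [b]. *)
  apply: (@no_embeds_pairwise G 6 _ (nth b [:: w 0; w 1; w 2; w 3; b; a])
           Gfree is_domino twin_free_domino).
  by rewrite /= ?(wb, wa, ba, ab, awm 3, b0, b1, b2, bj, wem 3).
have ej : j = 2 by lia.
subst j; have [j ltj' [bj' nbj']] := next 2 ltac:(lia).
have := gap 2 j ltj' bj bj' nbj'; case: (leqP j 3) => j2' j3'.
  have ej : j = 3 by lia.
  subst j.
  (* On the path [w 3], [w 2], [w 1], [w 0], [a], the vertex [b] misses only [w 0]. *)
  apply: (@no_embeds_pairwise G 6 _ (nth b [:: w 3; w 2; w 1; w 0; a; b])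
           Gfree is_X5 twin_free_X5).
  by rewrite /= ?(wb, wa, ba, ab, awm 3, b0, b1, bj, bj', wem 3).
have ej : j = 4 by lia.
subst j; have b3 := negbTE (nbj' 3 isT).
(* The triangle [b], [w 1], [w 2] has a square on its side [b], [w 1], through [a] and [w 0], and
   one on its side [b], [w 2], through [w 4] and [w 3]. *)
apply: (@no_embeds_pairwise G 7 _ (nth b [:: w 3; w 4; b; a; w 0; w 1; w 2])
         Gfree is_F twin_free_F).
by rewrite /= ?(wb, wa, ba, ab, awm 4, b0, b1, bj, b3, bj', wem 4).
Qed.

Lemma free_domination (G : sgraph) :
  free_of hole_D_F_X5 G -> domination_class m3 l3 G.
Proof.
move=> Gfree u v neq_uv nadj_uv W W' [iW k3] [iW' k'3] x xW'.
have eW : W = mkseq (nth u W) (wlength W).+1.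
  by apply: (@nth_mkseq_wlength _ u v); case: iW => [[]].
have eW' : W' = mkseq (nth u W') (wlength W').+1.
  by apply: (@nth_mkseq_wlength _ u v); case: iW' => [[]].
move: iW iW' xW'; rewrite {1}eW {1 2}eW' internal_mkseq.
move: (nth u W) (nth u W') (wlength W) (wlength W') k3 k'3 eW {eW'}.
move=> w w' k k' k3 k'3 eW.
case/induced_path_mkseq=> w0 wk _ we /induced_path_mkseq[w'0 w'k _ we'].
case/mapP=> i; rewrite mem_iota => lti ->{x}.
have [/hasP[l]|/hasPn nadj] :=
  boolP (has (fun l => adj (w' i) (w l)) (iota 1 k.-1)).
  rewrite mem_iota => ltl adjl; left; exists (w l) => //.
  by rewrite eW internal_mkseq map_f // mem_iota.
exfalso; have nadj' l : 0 < l < k -> adj (w' i) (w l) = false.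
  by move=> ltl; apply/negbTE/nadj; rewrite mem_iota; lia.
have [k'2|k'2] := eqVneq k' 2.
  subst k'; have ei : i = 1 by lia.
  subst i; apply: (@hole_of_path G w k (w' 1) Gfree k3 we) => l ltl.
  have [->|l0] := eqVneq l 0; first by rewrite w0 -w'0 we'.
  have [->|lk] := eqVneq l k; first by rewrite wk -w'k we'.
  by rewrite nadj' //; lia.
have ek' : k' = 3 by lia.
subst k'; have [i1|i2] : i = 1 \/ i = 2 by lia.
- subst i; apply: (@undominated_path_False G w k (w' 1) (w' 2) Gfree k3 we).
  + move=> l ltl; have [->|l0] := eqVneq l 0; first by rewrite w0 -w'0 we'.
    have [->|lk] := eqVneq l k; first by rewrite wk -w'k we'.
    by rewrite nadj' //; lia.
  + by rewrite w0 -w'0 we'.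
  + by rewrite wk -w'k we'.
  + by rewrite we'.
(* Both paths are reversed, so that the undominated vertex [w' 2] follows the starting end. *)
- subst i; apply: (@undominated_path_False G (fun l => w (k - l)) k (w' 2) (w' 1)
           Gfree k3).
  + by move=> l m ltl ltm; rewrite we /path_rel; lia.
  + move=> l ltl; have [->|l0] := eqVneq l 0; first by rewrite subn0 wk -w'k we'.
    have [->|lk] := eqVneq l k; first by rewrite subnn w0 -w'0 we'.
    by rewrite nadj' //; lia.
  + by rewrite subn0 wk -w'k we'.
  + by rewrite subnn w0 -w'0 we'.
  + by rewrite we'.
Qed.

Theorem theorem10 (G : sgraph) (Gconn : connected G) :
  domination_class m3 l3 G <-> free_of hole_D_F_X5 G.
Proof. by split; [apply: domination_free | apply: free_domination]. Qed.
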